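(* Let $\Phi\cup\{\chi\}\subseteq Fm_0$ be a set of propositional (modal-free) formulas. Then $$\square\Phi\vdash_L\square\chi \iff \Phi\vdash_{IPC}\chi,$$ where $\Phi\vdash_{IPC}\chi$ means that $\chi$ is derivable from $\Phi$ in intuitionistic propositional logic.
   Context: Let $V=\{x_0,x_1,x_2,\dots\}$ be an infinite set of propositional variables. The set $Fm$ of formulas is generated from $V$ by the constant $\bot$, the binary connectives $\rightarrow,\vee,\wedge$ and the unary modal operator $\square$; $Fm_0\subseteq Fm$ is the set of formulas not containing $\square$. Abbreviations: $\varphi\leftrightarrow\psi:=(\varphi\rightarrow\psi)\wedge(\psi\rightarrow\varphi)$, $\neg\varphi:=\varphi\rightarrow\bot$, $\top:=\neg\bot$, $\varphi\equiv\psi:=\square(\varphi\rightarrow\psi)\wedge\square(\psi\rightarrow\varphi)$, and $\square\Phi:=\{\square\varphi\mid\varphi\in\Phi\}$. $\varphi[x:=\psi]$ denotes the result of substituting $\psi$ for the variable $x$ in $\varphi$. The logic L is the Hilbert-style system whose axioms are all formulas of the forms: (i) substitution instances (variables replaced by arbitrary formulas of $Fm$) of intuitionistic propositional tautologies; (ii) $\square\varphi\rightarrow\varphi$; (iii) $\square(\varphi\rightarrow\psi)\rightarrow(\square(\psi\rightarrow\chi)\rightarrow\square(\varphi\rightarrow\chi))$; (iv) $\square(\varphi\vee\psi)\rightarrow(\square\varphi\vee\square\psi)$; whose rules are Modus Ponens (from $\varphi$ and $\varphi\rightarrow\psi$ infer $\psi$) and Axiom Necessitation (if $\varphi$ is an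 axiom of form (i)–(iv), infer $\square\varphi$); and which additionally has as theorems (usable in derivations, but not subject to Axiom Necessitation) all formulas $\varphi\vee\neg\varphi$ and all formulas $(\varphi\equiv\psi)\rightarrow(\chi[x:=\varphi]\equiv\chi[x:=\psi])$, for $\varphi,\psi,\chi\in Fm$ and $x\in V$. $\Phi\vdash_L\varphi$ means there is a derivation of $\varphi$ from assumptions $\Phi$ in L. *)

(* Defs.v *)
From Stdlib Require Import Arith Ensembles Image.

Inductive form : Type :=
| Var (n : nat)
| Bot
| Imp (phi psi : form)
| Or (phi psi : form)
| And (phi psi : form)
| Box (phi : form).

Definition Neg (phi : form) : form := Imp phi Bot.

(** Strict equivalence, the connective written as a three-bar equality. *)
Definition Equiv (phi psi : form) : form :=
  And (Box (Imp phi psi)) (Box (Imp psi phi)).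

Fixpoint Fm0 (phi : form) : Prop :=
  match phi with
  | Var _ | Bot => True
  | Imp a b | Or a b | And a b => Fm0 a /\ Fm0 b
  | Box _ => False
  end.

Fixpoint subst (s : nat -> form) (phi : form) : form :=
  match phi with
  | Var n => s n
  | Bot => Bot
  | Imp a b => Imp (subst s a) (subst s b)
  | Or a b => Or (subst s a) (subst s b)
  | And a b => And (subst s a) (subst s b)
  | Box a => Box (subst s a)
  end.

Definition subst1 (x : nat) (psi phi : form) : form :=
  subst (fun n => if n =? x then psi else Var n) phi.

Inductive ipc_scheme : form -> Prop :=
| ipc_K a b : ipc_scheme (Imp a (Imp b a))
| ipc_S a b c :
    ipc_scheme (Imp (Imp a (Imp b c)) (Imp (Imp a b) (Imp a c)))
| ipc_andI a b : ipc_scheme (Imp a (Imp b (And a b)))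
| ipc_andE1 a b : ipc_scheme (Imp (And a b) a)
| ipc_andE2 a b : ipc_scheme (Imp (And a b) b)
| ipc_orI1 a b : ipc_scheme (Imp a (Or a b))
| ipc_orI2 a b : ipc_scheme (Imp b (Or a b))
| ipc_orE a b c :
    ipc_scheme (Imp (Imp a c) (Imp (Imp b c) (Imp (Or a b) c)))
| ipc_botE a : ipc_scheme (Imp Bot a).

(** Derivations in IPC take place inside [Fm0]: both the assumptions used and
    the axiom instances are required to be modal-free, hence so is every
    formula of a derivation. *)
Inductive ipc (Phi : Ensemble form) : form -> Prop :=
| ipc_hyp phi : In form Phi phi -> Fm0 phi -> ipc Phi phi
| ipc_ax phi : ipc_scheme phi -> Fm0 phi -> ipc Phi phi
| ipc_mp phi psi : ipc Phi phi -> ipc Phi (Imp phi psi) -> ipc Phi psi.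

(** The axioms subject to Axiom Necessitation. *)
Inductive L_axiom : form -> Prop :=
| L_ipc (s : nat -> form) phi :
    ipc (Empty_set form) phi -> L_axiom (subst s phi)
| L_T phi : L_axiom (Imp (Box phi) phi)
| L_trans phi psi chi :
    L_axiom (Imp (Box (Imp phi psi))
                 (Imp (Box (Imp psi chi)) (Box (Imp phi chi))))
| L_disj phi psi :
    L_axiom (Imp (Box (Or phi psi)) (Or (Box phi) (Box psi))).

(** Necessitation applies only to [L_axiom] formulas, not to the instances of
    excluded middle ([L_tnd]) or of the substitution principle ([L_sp]). *)
Inductive L_der (Phi : Ensemble form) : form -> Prop :=
| L_hyp phi : In form Phi phi -> L_der Phi phi
| L_ax phi : L_axiom phi -> L_der Phi phi
| L_an phi : L_axiom phi -> L_der Phi (Box phi)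
| L_tnd phi : L_der Phi (Or phi (Neg phi))
| L_sp phi psi chi x :
    L_der Phi (Imp (Equiv phi psi)
                   (Equiv (subst1 x phi chi) (subst1 x psi chi)))
| L_mp phi psi : L_der Phi phi -> L_der Phi (Imp phi psi) -> L_der Phi psi.

Definition boxes (Phi : Ensemble form) : Ensemble form :=
  Im form form Phi Box.

(* Main.v *)
Require Import Defs.
From Stdlib Require Import Ensembles Image Arith Cantor Classical ClassicalEpsilon.

(** From right to left, the substitution principle applied to [phi] and
    [top -> phi] gives [Box phi -> Box (top -> phi)], so that transitivity of
    strict implication simulates Modus Ponens under boxes.

    From left to right, suppose [chi] is not IPC-derivable from [Phi].
    Lindenbaum's construction extends [Phi] to a prime theory [T] that does not
    derive [chi], and [T] to a maximal consistent theory [M].  Translate [Fm]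
    into [Fm0] by replacing each [Box a], innermost first, by top or bottom
    according to whether [T] derives the translation of [a].  The translations
    of the axioms are derivable from [T] (primality gives axiom (iv)), so those
    of their necessitations are top; excluded middle holds in [M]; and the
    substitution principle holds because translated formulas that are
    [T]-equivalent are indistinguishable under the box.  Hence [M] derives the
    translation of every L-consequence of the boxes of [Phi], whereas that of
    [Box chi] is bottom. *)

(** * Derived rules of IPC and the deduction theorem *)

Definition Top : form := Neg Bot.

Lemma ipc_Fm0 Phi phi : ipc Phi phi -> Fm0 phi.
Proof. induction 1; simpl in *; tauto. Qed.

Lemma ipc_mono (Phi Psi : Ensemble form) phi :
  Included form Phi Psi -> ipc Phi phi -> ipc Psi phi.
Proof.
  intros hsub H; induction H as [phi hin h0|phi hax h0|phi psi _ IH1 _ IH2].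
  - apply ipc_hyp; [apply hsub|]; assumption.
  - apply ipc_ax; assumption.
  - exact (ipc_mp _ _ _ IH1 IH2).
Qed.

Lemma ipc_assume Phi a : Fm0 a -> ipc (Add form Phi a) a.
Proof. intros ha; apply ipc_hyp; [apply Add_intro2 | exact ha]. Qed.

Lemma ipc_weaken Phi a phi : ipc Phi phi -> ipc (Add form Phi a) phi.
Proof. apply ipc_mono; intros x hx; apply Add_intro1; exact hx. Qed.

Lemma ipc_const Phi a b : Fm0 a -> ipc Phi b -> ipc Phi (Imp a b).
Proof.
  intros ha hb; apply (ipc_mp _ b); [exact hb|].
  apply ipc_Fm0 in hb; apply ipc_ax; [constructor | simpl; tauto].
Qed.

Lemma ipc_S_rule Phi a b c :
  ipc Phi (Imp a (Imp b c)) -> ipc Phi (Imp a b) -> ipc Phi (Imp a c).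
Proof.
  intros h1 h2; apply (ipc_mp _ _ _ h2), (ipc_mp _ _ _ h1).
  apply ipc_Fm0 in h1; apply ipc_ax; [constructor | simpl in *; tauto].
Qed.

Lemma ipc_refl Phi a : Fm0 a -> ipc Phi (Imp a a).
Proof.
  intros ha; apply (ipc_S_rule _ _ (Imp a a));
    apply ipc_ax; try constructor; simpl; tauto.
Qed.

Lemma ipc_deduction Phi a phi :
  Fm0 a -> ipc (Add form Phi a) phi -> ipc Phi (Imp a phi).
Proof.
  intros ha H; induction H as [phi hin h0|phi hax h0|phi psi _ IH1 _ IH2].
  - apply Add_inv in hin as [hin| <-].
    + apply ipc_const; [exact ha | apply ipc_hyp; assumption].
    + apply ipc_refl, ha.
  - apply ipc_const; [exact ha | apply ipc_ax; assumption].
  - exact (ipc_S_rule _ _ _ _ IH2 IH1).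
Qed.

Lemma ipc_conj Phi a b : ipc Phi a -> ipc Phi b -> ipc Phi (And a b).
Proof.
  intros ha hb; apply (ipc_mp _ _ _ hb), (ipc_mp _ _ _ ha).
  apply ipc_Fm0 in ha; apply ipc_Fm0 in hb.
  apply ipc_ax; [constructor | simpl; tauto].
Qed.

Lemma ipc_proj1 Phi a b : ipc Phi (And a b) -> ipc Phi a.
Proof.
  intros h; apply (ipc_mp _ _ _ h); apply ipc_Fm0 in h.
  apply ipc_ax; [constructor | simpl in *; tauto].
Qed.

Lemma ipc_proj2 Phi a b : ipc Phi (And a b) -> ipc Phi b.
Proof.
  intros h; apply (ipc_mp _ _ _ h); apply ipc_Fm0 in h.
  apply ipc_ax; [constructor | simpl in *; tauto].
Qed.

Lemma ipc_introl Phi a b : Fm0 b -> ipc Phi a -> ipc Phi (Or a b).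
Proof.
  intros hb h; apply (ipc_mp _ _ _ h); apply ipc_Fm0 in h.
  apply ipc_ax; [constructor | simpl; tauto].
Qed.

Lemma ipc_intror Phi a b : Fm0 a -> ipc Phi b -> ipc Phi (Or a b).
Proof.
  intros ha h; apply (ipc_mp _ _ _ h); apply ipc_Fm0 in h.
  apply ipc_ax; [constructor | simpl; tauto].
Qed.

Lemma ipc_cases Phi a b c :
  ipc Phi (Or a b) -> ipc Phi (Imp a c) -> ipc Phi (Imp b c) -> ipc Phi c.
Proof.
  intros h ha hb; apply (ipc_mp _ _ _ h), (ipc_mp _ _ _ hb), (ipc_mp _ _ _ ha).
  apply ipc_Fm0 in ha; apply ipc_Fm0 in hb.
  apply ipc_ax; [constructor | simpl in *; tauto].
Qed.

Lemma ipc_exfalso Phi a : Fm0 a -> ipc Phi Bot -> ipc Phi a.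
Proof.
  intros ha h; apply (ipc_mp _ _ _ h).
  apply ipc_ax; [constructor | simpl; tauto].
Qed.

Lemma ipc_Bot_imp Phi a : Fm0 a -> ipc Phi (Imp Bot a).
Proof. intros ha; apply ipc_ax; [constructor | simpl; tauto]. Qed.

Lemma ipc_Top Phi : ipc Phi Top.
Proof. apply ipc_refl; exact I. Qed.

(** * Lindenbaum's construction along a numbering of the formulas *)

Fixpoint code (phi : form) : nat :=
  match phi with
  | Var n => to_nat (0, n)
  | Bot => to_nat (1, 0)
  | Imp a b => to_nat (2, to_nat (code a, code b))
  | Or a b => to_nat (3, to_nat (code a, code b))
  | And a b => to_nat (4, to_nat (code a, code b))
  | Box a => to_nat (5, code a)
  end.

Lemma code_inj phi psi : code phi = code psi -> phi = psi.
Proof.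
  revert psi; induction phi; intros [] e; cbn [code] in e;
    apply to_nat_inj, pair_equal_spec in e as [tag e]; try discriminate tag;
    try apply to_nat_inj, pair_equal_spec in e as [e1 e2]; f_equal; auto.
Qed.

(** Step [m] considers the formula of code [m], if there is one, and adds it unless [chi] would
    become derivable. *)
Fixpoint stage (Phi : Ensemble form) (chi : form) (n : nat) : Ensemble form :=
  match n with
  | 0 => Phi
  | S m => fun phi =>
      stage Phi chi m phi \/
      (code phi = m /\ ~ ipc (Add form (stage Phi chi m) phi) chi)
  end.

Definition stages (Phi : Ensemble form) (chi : form) : Ensemble form :=
  fun phi => exists n, stage Phi chi n phi.

Lemma stage_mono Phi chi m n :
  m <= n -> Included form (stage Phi chi m) (stage Phi chi n).
Proof.
  induction 1 as [|n _ IH]; intros phi h; [exact h|].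
  left; apply IH, h.
Qed.

(** By injectivity of [code], each step adds at most one formula, and only one whose addition leaves
    [chi] underivable. *)
Lemma stage_unprovable Phi chi n :
  ~ ipc Phi chi -> ~ ipc (stage Phi chi n) chi.
Proof.
  intros h0; induction n as [|n IH]; [exact h0|]; intros h.
  destruct (classic (exists phi, code phi = n /\
    ~ ipc (Add form (stage Phi chi n) phi) chi)) as [[phi [hc hn]]|hno].
  - apply hn; revert h; apply ipc_mono; intros psi [hp|[hp _]].
    + apply Add_intro1; exact hp.
    + rewrite (code_inj psi phi) by congruence; apply Add_intro2.
  - apply IH; revert h; apply ipc_mono; intros psi [hp|hp]; [exact hp|].
    destruct hno; exists psi; exact hp.
Qed.

(** A derivation uses finitely many assumptions, and the stages increase, so one stage contains them
    all. *)
Lemma ipc_stages_compact Phi chi phi :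
  ipc (stages Phi chi) phi -> exists n, ipc (stage Phi chi n) phi.
Proof.
  induction 1 as [phi [n hn] h0|phi hax h0|phi psi _ [m hm] _ [n hn]].
  - exists n; apply ipc_hyp; assumption.
  - exists 0; apply ipc_ax; assumption.
  - exists (max m n); apply (ipc_mp _ phi).
    + revert hm; apply ipc_mono, stage_mono, Nat.le_max_l.
    + revert hn; apply ipc_mono, stage_mono, Nat.le_max_r.
Qed.

(** The last clause is maximality: a formula rejected at its own stage derives [chi] together with
    that stage, so the deduction theorem applies. *)
Lemma lindenbaum Phi chi :
  ~ ipc Phi chi ->
  exists T, Included form Phi T /\ ~ ipc T chi /\
    forall phi, Fm0 phi -> ipc T phi \/ ipc T (Imp phi chi).
Proof.
  intros h; exists (stages Phi chi); split; [|split].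
  - intros phi hphi; exists 0; exact hphi.
  - intros hc; apply ipc_stages_compact in hc as [n hn].
    exact (stage_unprovable _ _ n h hn).
  - intros phi h0.
    destruct (classic (ipc (Add form (stage Phi chi (code phi)) phi) chi))
      as [hy|hn].
    + right; apply ipc_deduction; [exact h0|].
      revert hy; apply ipc_mono; intros psi hpsi.
      apply Add_inv in hpsi as [hpsi| <-]; [|apply Add_intro2].
      apply Add_intro1; exists (code phi); exact hpsi.
    + left; apply ipc_hyp; [|exact h0].
      exists (S (code phi)); right; split; [reflexivity | exact hn].
Qed.

Lemma lindenbaum_prime T chi :
  ~ ipc T chi ->
  (forall phi, Fm0 phi -> ipc T phi \/ ipc T (Imp phi chi)) ->
  forall a b, ipc T (Or a b) -> ipc T a \/ ipc T b.
Proof.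
  intros hchi hmax a b hab; pose proof (ipc_Fm0 _ _ hab) as [ha hb].
  destruct (hmax a ha) as [|ha']; [tauto|].
  destruct (hmax b hb) as [|hb']; [tauto|].
  destruct hchi; exact (ipc_cases _ _ _ _ hab ha' hb').
Qed.

(** * Substitution and the translation into modal-free formulas *)

Lemma Fm0_subst s phi : (forall n, Fm0 (s n)) -> Fm0 phi -> Fm0 (subst s phi).
Proof. intros hs; induction phi; simpl; intuition auto. Qed.

Lemma subst_Var phi : subst Var phi = phi.
Proof. induction phi; simpl; congruence. Qed.

Lemma ipc_scheme_subst s phi : ipc_scheme phi -> ipc_scheme (subst s phi).
Proof. intros []; constructor. Qed.

Lemma ipc_subst s phi : (forall n, Fm0 (s n)) ->
  ipc (Empty_set form) phi -> ipc (Empty_set form) (subst s phi).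
Proof.
  intros hs; induction 1 as [phi hin h0|phi hax h0|phi psi _ IH1 _ IH2].
  - destruct hin.
  - apply ipc_ax; [apply ipc_scheme_subst | apply Fm0_subst]; assumption.
  - exact (ipc_mp _ _ _ IH1 IH2).
Qed.

Fixpoint unbox (T : Ensemble form) (phi : form) : form :=
  match phi with
  | Var n => Var n
  | Bot => Bot
  | Imp a b => Imp (unbox T a) (unbox T b)
  | Or a b => Or (unbox T a) (unbox T b)
  | And a b => And (unbox T a) (unbox T b)
  | Box a => if excluded_middle_informative (ipc T (unbox T a))
             then Top else Bot
  end.

Lemma unbox_Box_Top T a : ipc T (unbox T a) -> unbox T (Box a) = Top.
Proof. intros h; simpl; destruct excluded_middle_informative; tauto. Qed.

Lemma unbox_Box_Bot T a : ~ ipc T (unbox T a) -> unbox T (Box a) = Bot.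
Proof. intros h; simpl; destruct excluded_middle_informative; tauto. Qed.

Lemma Fm0_unbox T phi : Fm0 (unbox T phi).
Proof.
  induction phi; simpl; try destruct excluded_middle_informative; simpl; tauto.
Qed.

Lemma unbox_Fm0 T phi : Fm0 phi -> unbox T phi = phi.
Proof. induction phi; simpl; intuition congruence. Qed.

(** Thus an instance of a tautology translates to a modal-free instance of the same tautology. *)
Lemma unbox_subst T s phi :
  Fm0 phi -> unbox T (subst s phi) = subst (fun n => unbox T (s n)) phi.
Proof. induction phi; simpl; intuition congruence. Qed.

(** Derivability from [T] itself, and not merely from an extension, is what turns necessitated
    axioms into [Top]. *)
Lemma unbox_axiom T phi :
  (forall a b, ipc T (Or a b) -> ipc T a \/ ipc T b) ->
  L_axiom phi -> ipc T (unbox T phi).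
Proof.
  intros hprime [s a ha|a|a b c|a b].
  - rewrite unbox_subst by exact (ipc_Fm0 _ _ ha).
    apply (ipc_mono (Empty_set form)); [intros x []|].
    apply ipc_subst; [intros n; apply Fm0_unbox | exact ha].
  (* The boxes stay folded so that they can be rewritten to [Top] or [Bot]; a [Bot] antecedent makes
     the implication trivial. *)
  - change (ipc T (Imp (unbox T (Box a)) (unbox T a))).
    destruct (classic (ipc T (unbox T a))) as [h|h].
    + apply ipc_const; [apply Fm0_unbox | exact h].
    + rewrite unbox_Box_Bot by exact h; apply ipc_Bot_imp, Fm0_unbox.
  - change (ipc T (Imp (unbox T (Box (Imp a b)))
      (Imp (unbox T (Box (Imp b c))) (unbox T (Box (Imp a c)))))).
    destruct (classic (ipc T (unbox T (Imp a b)))) as [h1|h1].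
    2: { rewrite (unbox_Box_Bot _ (Imp a b)) by exact h1.
         apply ipc_Bot_imp; split; apply Fm0_unbox. }
    apply ipc_const; [apply Fm0_unbox|].
    destruct (classic (ipc T (unbox T (Imp b c)))) as [h2|h2].
    2: { rewrite (unbox_Box_Bot _ (Imp b c)) by exact h2.
         apply ipc_Bot_imp, Fm0_unbox. }
    apply ipc_const; [apply Fm0_unbox|].
    rewrite unbox_Box_Top; [apply ipc_Top|].
    apply (ipc_S_rule _ _ (unbox T b)); [|exact h1].
    apply ipc_const; [apply Fm0_unbox | exact h2].
  - change (ipc T (Imp (unbox T (Box (Or a b)))
      (Or (unbox T (Box a)) (unbox T (Box b))))).
    destruct (classic (ipc T (unbox T (Or a b)))) as [h|h].
    + apply ipc_const; [apply Fm0_unbox|].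
      destruct (hprime _ _ h) as [h'|h'].
      * apply ipc_introl; [apply Fm0_unbox|].
        rewrite unbox_Box_Top by exact h'; apply ipc_Top.
      * apply ipc_intror; [apply Fm0_unbox|].
        rewrite unbox_Box_Top by exact h'; apply ipc_Top.
    + rewrite (unbox_Box_Bot _ (Or a b)) by exact h.
      apply ipc_Bot_imp; split; apply Fm0_unbox.
Qed.

(** * Congruence of the translation and soundness *)

Definition ipc_equiv (T : Ensemble form) (a b : form) : Prop :=
  ipc T (Imp a b) /\ ipc T (Imp b a).

Lemma ipc_imp_mono T a a' b b' :
  ipc T (Imp a' a) -> ipc T (Imp b b') -> ipc T (Imp (Imp a b) (Imp a' b')).
Proof.
  intros ha hb.
  pose proof (ipc_Fm0 _ _ ha) as [h1 h2]; pose proof (ipc_Fm0 _ _ hb) as [h3 h4].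
  apply ipc_deduction; [split; assumption|].
  apply ipc_deduction; [assumption|].
  apply (ipc_mp _ b); [|do 2 apply ipc_weaken; exact hb].
  apply (ipc_mp _ a); [|apply ipc_weaken, ipc_assume; split; assumption].
  apply (ipc_mp _ a'); [apply ipc_assume; assumption|].
  do 2 apply ipc_weaken; exact ha.
Qed.

Lemma ipc_or_mono T a a' b b' :
  ipc T (Imp a a') -> ipc T (Imp b b') -> ipc T (Imp (Or a b) (Or a' b')).
Proof.
  intros ha hb.
  pose proof (ipc_Fm0 _ _ ha) as [h1 h2]; pose proof (ipc_Fm0 _ _ hb) as [h3 h4].
  apply ipc_deduction; [split; assumption|].
  apply (ipc_cases _ a b); [apply ipc_assume; split; assumption| |];
    apply ipc_weaken, ipc_deduction; try assumption.
  - apply ipc_introl; [assumption|].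
    apply (ipc_mp _ a); [apply ipc_assume; assumption | apply ipc_weaken, ha].
  - apply ipc_intror; [assumption|].
    apply (ipc_mp _ b); [apply ipc_assume; assumption | apply ipc_weaken, hb].
Qed.

Lemma ipc_and_mono T a a' b b' :
  ipc T (Imp a a') -> ipc T (Imp b b') -> ipc T (Imp (And a b) (And a' b')).
Proof.
  intros ha hb.
  pose proof (ipc_Fm0 _ _ ha) as [h1 h2]; pose proof (ipc_Fm0 _ _ hb) as [h3 h4].
  apply ipc_deduction; [split; assumption|].
  assert (hab : ipc (Add form T (And a b)) (And a b))
    by (apply ipc_assume; split; assumption).
  apply ipc_conj.
  - apply (ipc_mp _ _ _ (ipc_proj1 _ _ _ hab)), ipc_weaken, ha.
  - apply (ipc_mp _ _ _ (ipc_proj2 _ _ _ hab)), ipc_weaken, hb.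
Qed.

(** Under a box, equivalence over [T] becomes equality: [T] derives both bodies or neither, so both
    boxes become the same constant. *)
Lemma unbox_congr T s s' phi :
  (forall n, ipc_equiv T (unbox T (s n)) (unbox T (s' n))) ->
  ipc_equiv T (unbox T (subst s phi)) (unbox T (subst s' phi)).
Proof.
  intros hs.
  induction phi as [n| |a [IHa1 IHa2] b [IHb1 IHb2]|a [IHa1 IHa2] b [IHb1 IHb2]
                   |a [IHa1 IHa2] b [IHb1 IHb2]|a [IHa1 IHa2]].
  - apply hs.
  - split; apply ipc_refl; exact I.
  - split; apply ipc_imp_mono; assumption.
  - split; apply ipc_or_mono; assumption.
  - split; apply ipc_and_mono; assumption.
  - cbn [subst].
    destruct (classic (ipc T (unbox T (subst s a)))) as [h|h].
    + rewrite !unbox_Box_Top; [split; apply ipc_refl; simpl; tauto| |exact h].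
      exact (ipc_mp _ _ _ h IHa1).
    + rewrite !unbox_Box_Bot; [split; apply ipc_refl; simpl; tauto| |exact h].
      intros h'; apply h; exact (ipc_mp _ _ _ h' IHa2).
Qed.

Lemma unbox_Equiv_Top T a b :
  ipc_equiv T (unbox T a) (unbox T b) -> unbox T (Equiv a b) = And Top Top.
Proof.
  intros [h1 h2].
  change (unbox T (Equiv a b)) with
    (And (unbox T (Box (Imp a b))) (unbox T (Box (Imp b a)))).
  f_equal; apply unbox_Box_Top; assumption.
Qed.

Lemma unbox_Equiv_Bot T Psi a b :
  ~ ipc_equiv T (unbox T a) (unbox T b) ->
  ipc Psi (Imp (unbox T (Equiv a b)) Bot).
Proof.
  intros h.
  change (unbox T (Equiv a b)) with
    (And (unbox T (Box (Imp a b))) (unbox T (Box (Imp b a)))).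
  (* Once one conjunct is rewritten to [Bot], the goal is a projection axiom. *)
  apply ipc_ax; [|repeat split; apply Fm0_unbox].
  destruct (classic (ipc T (unbox T (Imp a b)))) as [h1|h1].
  - rewrite (unbox_Box_Bot _ (Imp b a)); [constructor|].
    intros h2; apply h; split; assumption.
  - rewrite (unbox_Box_Bot _ (Imp a b)) by exact h1; constructor.
Qed.

(** Two theories are needed: [T] evaluates the boxes and is prime, while its extension [M] decides
    every modal-free formula. *)
Lemma unbox_sound (Phi T M : Ensemble form) phi :
  Included form Phi Fm0 -> Included form Phi T ->
  (forall a b, ipc T (Or a b) -> ipc T a \/ ipc T b) ->
  Included form T M ->
  (forall a, Fm0 a -> ipc M a \/ ipc M (Neg a)) ->
  L_der (boxes Phi) phi -> ipc M (unbox T phi).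
Proof.
  intros hPhi hT hprime hM hmax.
  induction 1 as [phi hin|phi hax|phi hax|phi|phi psi chi x
                 |phi psi _ IH1 _ IH2].
  - destruct hin as [phi hphi ? ->].
    rewrite unbox_Box_Top; [apply ipc_Top|].
    rewrite unbox_Fm0 by exact (hPhi _ hphi).
    apply ipc_hyp; [exact (hT _ hphi) | exact (hPhi _ hphi)].
  - apply (ipc_mono T); [exact hM | apply unbox_axiom; assumption].
  - rewrite unbox_Box_Top; [apply ipc_Top | apply unbox_axiom; assumption].
  - change (ipc M (Or (unbox T phi) (Neg (unbox T phi)))).
    pose proof (Fm0_unbox T phi) as h0.
    destruct (hmax _ h0) as [h|h].
    + apply ipc_introl; [simpl; tauto | exact h].
    + apply ipc_intror; assumption.
  - change (ipc M (Imp (unbox T (Equiv phi psi))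
      (unbox T (Equiv (subst1 x phi chi) (subst1 x psi chi))))).
    destruct (classic (ipc_equiv T (unbox T phi) (unbox T psi))) as [h|h].
    + apply ipc_const; [apply Fm0_unbox|].
      rewrite unbox_Equiv_Top; [apply ipc_conj; apply ipc_Top|].
      apply unbox_congr; intros n.
      destruct (n =? x); [exact h | split; apply ipc_refl; exact I].
    + apply (ipc_S_rule _ _ Bot).
      * apply ipc_const; [|apply ipc_Bot_imp]; apply Fm0_unbox.
      * apply unbox_Equiv_Bot; exact h.
  - exact (ipc_mp _ _ _ IH1 IH2).
Qed.

(** * Simulating IPC under boxes in L *)

Lemma L_axiom_ipc phi : ipc (Empty_set form) phi -> L_axiom phi.
Proof. intros h; rewrite <- (subst_Var phi); constructor; exact h. Qed.

Lemma L_conj Phi a b : L_der Phi a -> L_der Phi b -> L_der Phi (And a b).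
Proof.
  intros ha hb; apply (L_mp _ _ _ hb), (L_mp _ _ _ ha), L_ax.
  (* Since [a] and [b] may contain boxes, the tautology is derived for two variables and then
     instantiated. *)
  apply (L_ipc (fun n => match n with 0 => a | _ => b end)
    (Imp (Var 0) (Imp (Var 1) (And (Var 0) (Var 1))))).
  apply ipc_ax; [constructor | simpl; tauto].
Qed.

Lemma L_proj1 Phi a b : L_der Phi (And a b) -> L_der Phi a.
Proof.
  intros h; apply (L_mp _ _ _ h), L_ax.
  apply (L_ipc (fun n => match n with 0 => a | _ => b end)
    (Imp (And (Var 0) (Var 1)) (Var 0))).
  apply ipc_ax; [constructor | simpl; tauto].
Qed.

Lemma L_unbox Phi a : L_der Phi (Box a) -> L_der Phi a.
Proof. intros h; apply (L_mp _ _ _ h), L_ax, L_T. Qed.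

(* The substitution principle is used in the context [Box (Var 0)]. *)
Lemma L_Box_equiv Phi a b :
  L_der Phi (Box (Imp a b)) -> L_der Phi (Box (Imp b a)) ->
  L_der Phi (Box a) -> L_der Phi (Box b).
Proof.
  intros h1 h2 h; apply (L_mp _ _ _ h), L_unbox.
  apply (L_proj1 _ _ (Box (Imp (Box b) (Box a)))).
  exact (L_mp _ _ _ (L_conj _ _ _ h1 h2) (L_sp Phi a b (Box (Var 0)) 0)).
Qed.

Lemma L_Box_mp Phi a b : Fm0 a -> Fm0 b ->
  L_der Phi (Box a) -> L_der Phi (Box (Imp a b)) -> L_der Phi (Box b).
Proof.
  (* Both implications are IPC theorems for modal-free [c], hence open to necessitation. *)
  assert (E : forall c, Fm0 c -> L_der Phi (Box (Imp c (Imp Top c))) /\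
                                 L_der Phi (Box (Imp (Imp Top c) c))).
  { intros c hc; split; apply L_an, L_axiom_ipc.
    - apply ipc_ax; [constructor | simpl; tauto].
    - apply ipc_deduction; [simpl; tauto|].
      apply (ipc_mp _ Top); [apply ipc_Top | apply ipc_assume; simpl; tauto]. }
  intros ha hb h hab.
  destruct (E a ha) as [Ea1 Ea2], (E b hb) as [Eb1 Eb2].
  apply (L_Box_equiv _ (Imp Top b) b Eb2 Eb1).
  apply (L_mp _ _ _ hab).
  apply (L_mp _ _ _ (L_Box_equiv _ _ _ Ea1 Ea2 h)), L_ax, L_trans.
Qed.

Lemma ipc_L_Box Phi phi : ipc Phi phi -> L_der (boxes Phi) (Box phi).
Proof.
  induction 1 as [phi hin h0|phi hax h0|phi psi _ IH1 h2 IH2].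
  - apply L_hyp; exact (Im_intro _ _ _ _ _ hin _ eq_refl).
  - apply L_an, L_axiom_ipc, ipc_ax; assumption.
  - destruct (ipc_Fm0 _ _ h2) as [ha hb]; exact (L_Box_mp _ _ _ ha hb IH1 IH2).
Qed.

Theorem theorem5p1 (Phi : Ensemble form) (chi : form)
    (hPhi : Included form Phi Fm0) (hchi : In form Fm0 chi) :
  L_der (boxes Phi) (Box chi) <-> ipc Phi chi.
Proof.
  split; [|apply ipc_L_Box].
  intros hL; apply NNPP; intros hn.
  destruct (lindenbaum _ _ hn) as [T [hT [hTchi hTmax]]].
  assert (hTBot : ~ ipc T Bot)
    by (intros h; apply hTchi, ipc_exfalso; assumption).
  (* For the target [Bot], the maximality clause reads: [M] derives each modal-free formula or its
     negation. *)
  destruct (lindenbaum _ _ hTBot) as [M [hM [hMBot hMmax]]].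
  apply hMBot.
  (* Being modal-free, [chi] is its own translation, and [T] does not derive it. *)
  rewrite <- (unbox_Box_Bot T chi) by (rewrite unbox_Fm0; assumption).
  apply (unbox_sound Phi T M); try assumption.
  exact (lindenbaum_prime T chi hTchi hTmax).
Qed.
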